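(* The topological entropy of the period tripling renormalization operator $R$ on the space of $C^{1+Lip}$ unimodal maps is unbounded (infinite): for every $n\ge 1$ a full $n$-shift is embedded in the domain of $R$, i.e. there is an $R$-invariant subset of the domain of $R$ on which $R$ is topologically conjugate to the full shift on $n$ symbols.
   Context: A unimodal map is a $C^1$ map $f:[0,1]\to[0,1]$ with a unique critical point $c$, normalized here by $f(c)=1$, $f(1)=0$. It is $C^{1+Lip}$ if its derivative is Lipschitz. $f$ is period tripling renormalizable if $f(0)<c<f^4(0)$ and, with $J=[f(0),f^4(0)]$ a proper subinterval, the intervals $f^2(J),J,f(J)$ have pairwise disjoint interiors, lie in this order from left to right, and $f^3(J)\subset J$. Then $Rf=h^{-1}\circ f^3\circ h$ with $h:[0,1]\to J$ the orientation reversing affine homeomorphism; the operator $R$ is defined on the set of period tripling renormalizable $C^{1+Lip}$ unimodal maps. The space of maps carries the $C^1$ topology, and the topological entropy of $R$ is the supremum of $h_{top}(R|_\Lambda)$ over compact sets $\Lambda$ in its domain with $R(\Lambda)\subset\Lambda$ on which $R$ is continuous. The full shift on $n$ symbols is the one-sided shift on $\{0,\ldots,n-1\}^{\mathbb N}$. *)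

(* Defs.v *)
From mathcomp Require Import all_boot all_order all_algebra.
From mathcomp Require Import all_classical all_reals all_analysis.

Set Implicit Arguments.
Unset Strict Implicit.
Unset Printing Implicit Defensive.

Import Order.TTheory GRing.Theory Num.Theory.
Import numFieldNormedType.Exports.

Local Open Scope classical_set_scope.
Local Open Scope ring_scope.

(* A map on [0, 1] is represented by the function R -> R that agrees with it on
   [0, 1] and vanishes elsewhere, so that Leibniz equality of representatives
   is equality of maps on [0, 1]. *)

Section C1.
Context {R : realType}.
Implicit Types (f : R -> R) (c : R).

Definition slope01 f (x : R) : set_system R :=
  (f y - f x) / (y - x) @[y --> within `[0, 1] x^'].

(* Derivative relative to [0, 1]: one-sided at 0 and at 1. *)
Definition D01 f (x : R) : R := lim (slope01 f x).

Definition C1_01 f : Prop :=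
  (forall x, x \in `[0, 1] -> cvg (slope01 f x)) /\
  {within `[0, 1], continuous (D01 f)}.

Definition jet01 f : arrow_uniform_type `[0, 1]%classic (R * R)%type :=
  fun x => (f (val x), D01 f (val x)).

(* The topology induced by uniform convergence on [0, 1] of (f, D01 f): on C^1
   maps of [0, 1] it is the C^1 topology, and [ball f e g] says that
   |f - g| < e and |f' - g'| < e pointwise on [0, 1].  The carrier is all of
   R -> R; the sets below contain C^1 maps only. *)
Definition C1space : pseudoMetricType R := initial_topology jet01.

Definition unimodal_with f c : Prop :=
  [/\ C1_01 f,
      forall x, x \in `[0, 1] -> f x \in `[0, 1],
      forall x, x \notin `[0, 1] -> f x = 0,
      [set x | x \in `[0, 1] /\ D01 f x = 0] = [set c] &
      f c = 1 /\ f 1 = 0].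

Definition C1Lip_01 f : Prop :=
  C1_01 f /\ [lipschitz D01 f x | x in `[0, 1]].

Definition C1Lip_unimodal : set C1space :=
  [set f | (exists c, unimodal_with f c) /\ C1Lip_01 f].

Definition lies_left (A B : set R) : Prop :=
  forall x y, A x -> B y -> x <= y.

Definition Jtrip f : set R := `[f 0, iter 4 f 0].

Definition tripling_renormalizable f : Prop :=
  exists c, unimodal_with f c /\
  let J := Jtrip f in
  [/\ f 0 < c < iter 4 f 0,
      J `<` `[0, 1],
      [/\ (iter 2 f @` J)° `&` J° = set0,
          J° `&` (f @` J)° = set0 &
          (iter 2 f @` J)° `&` (f @` J)° = set0],
      [/\ lies_left (iter 2 f @` J) J,
          lies_left J (f @` J) &
          lies_left (iter 2 f @` J) (f @` J)] &
      iter 3 f @` J `<=` J].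

Definition dom_renorm : set C1space :=
  [set f | C1Lip_unimodal f /\ tripling_renormalizable f].

(* The orientation reversing affine map of [0, 1] onto [f 0, f^4 0], and its
   inverse. *)
Definition hJ f (x : R) : R := iter 4 f 0 - (iter 4 f 0 - f 0) * x.
Definition hJinv f (x : R) : R := (iter 4 f 0 - x) / (iter 4 f 0 - f 0).

(* Only meaningful on dom_renorm. *)
Definition renorm (f : C1space) : C1space :=
  fun x => if x \in `[0, 1] then hJinv f (iter 3 f (hJ f x)) else 0.

End C1.

Arguments C1space R : clear implicits.

Section Entropy.
Context {R : realType} {T : pseudoMetricType R}.
Implicit Types (F : T -> T) (L : set T).

(* The distinct points listed in s are (n, e)-separated under F. *)
Definition separated F n (e : R) (s : seq T) : Prop :=
  uniq s /\ forall x y, x \in s -> y \in s -> x != y ->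
    exists2 i, (i < n)%N & ~ ball (iter i F x) e (iter i F y).

Definition max_separated F L n (e : R) : \bar R :=
  ereal_sup [set (size s)%:R%:E | s in
    [set s : seq T | {in s, forall x, L x} /\ separated F n e s]].

(* Topological entropy of F restricted to an F-invariant compact set L, in
   Bowen's form; for compact L on which F is continuous it depends only on the
   topology. *)
Definition htop F L : \bar R :=
  ereal_sup [set limn_esup (fun n =>
      (n.+1%:R^-1)%:E * lne (max_separated F L n.+1 e))%E
    | e in [set e : R | 0 < e]].

(* Entropy of a map F defined on dom, taken over compact invariant subsets. *)
Definition htop_sup F (dom : set T) : \bar R :=
  ereal_sup [set htop F L | L in
    [set L : set T | [/\ compact L, L `<=` dom, F @` L `<=` L &
                         {within L, continuous F}]]].

End Entropy.

(* {0, ..., n-1}^nat with the product of the discrete topologies *)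
Definition shift_space (n : nat) : topologicalType :=
  prod_topology (fun _ : nat => discrete_topology 'I_n).

Definition full_shift n (x : shift_space n) : shift_space n := fun i => x i.+1.

(* phi is a homeomorphism of Y onto L, with inverse psi, carrying G to F. *)
Definition conjugate_on {X Y : topologicalType} (F : X -> X) (L : set X)
    (G : Y -> Y) : Prop :=
  exists (phi : Y -> X) (psi : X -> Y),
    [/\ continuous phi, range phi = L, {within L, continuous psi},
        cancel phi psi & forall y, phi (G y) = F (phi y)].

(* Main.v *)
Require Import Defs.
From mathcomp Require Import all_boot all_order all_algebra.
From mathcomp Require Import all_classical all_reals all_analysis.
From mathcomp Require Import ring lra.
Set Implicit Arguments.
Unset Strict Implicit.
Unset Printing Implicit Defensive.
Import Order.TTheory GRing.Theory Num.Theory.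
Import numFieldNormedType.Exports.
Local Open Scope classical_set_scope.
Local Open Scope ring_scope.

(** Renormalization restricts [f] to [J] and rescales, so it forgets the values
of [f] in the gaps between the three intervals.  The converse operation
[unrenorm] rebuilds a map from its renormalization [g]: on [J = [p, q]] it
places a copy of [g], scaled by [a = |J|] horizontally (with reversal) and by
[b] vertically; on [f(J) = [1 - b, 1]] and on [[0, p]], which contains [f^2(J)],
it is affine, so that [f^3] on [J] is conjugate to [g]; in the gap [[q, 1 - b]]
it may be any decreasing function with the right values and slopes at the ends.
Here [a = 1/5], [b = 1/25], [p = 12/25], [q = 17/25], and the gap function is a
cubic plus [e] times a small quartic bump, with a free parameter [e] in [[0, 1]].

Iterating this construction with gap parameters [w 0], [w 1], and so on gives in
the limit a map [tower w], and renormalization acts on these maps as the shift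
on [w] ([renorm_tower]).  All the copies of [J] share the fixed point
[c = 17/30] of the rescaling, which becomes the critical point.  The class
C^{1+Lip} survives the infinite nesting because one level multiplies second
derivatives by [b / a ^ 2 = 1].  Quantitatively, the estimate [jet_on],
[|f y - f x - d x (y - x)| <= K (y - x)^2], is preserved with the same constant
under gluing of adjacent intervals ([jet_on_glue]), under rescaling
([jet_unrenorm]) and in pointwise limits ([jet_tower]); it says at once that [d]
is the derivative of [f] and that [d] is Lipschitz ([jet_C1Lip]).

Restricting the parameters to the [n] values [i / n] embeds the full [n]-shift
([code]).  Two such maps are C^1 close when their parameters agree for a long
time ([tower_close]), and the [i]-th parameter can be read off from the value at
a single point of the [i]-th nested gap ([symbol_read]), which makes the
embedding a homeomorphism onto a compact invariant set.  The words of length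
[N] give [n ^ N] maps that are [(N, e)]-separated with [e] independent of [N],
hence the entropy is at least [ln n] for every [n]. *)

(** * Second-order estimates *)

Section Jets.
Context {R : realType}.
Implicit Types (f d : R -> R) (K u v x y : R).

(** First-order Taylor expansion with quadratic error, uniform on an interval:
both the differentiability of [f] and the regularity of [d] in one inequality. *)
Definition jet_on K u v f d := forall x y, u <= x <= v -> u <= y <= v ->
  `|f y - f x - d x * (y - x)| <= K * (y - x) ^+ 2.

(** The expansions from [x] to [y] and from [y] to [x] add up to
[(d y - d x) (y - x)]. *)
Lemma jet_on_lip K u v f d : jet_on K u v f d ->
  forall x y, u <= x <= v -> u <= y <= v -> `|d y - d x| <= 2 * K * `|y - x|.
Proof.
move=> fd x y xuv yuv; have [->|yx] := eqVneq y x.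
  by rewrite !subrr normr0 mulr0.
rewrite -(ler_pM2r (_ : 0 < `|y - x|)) ?normr_gt0 ?subr_eq0// -normrM.
have -> : (d y - d x) * (y - x) =
  (f x - f y - d y * (x - y)) + (f y - f x - d x * (y - x)) by ring.
rewrite (le_trans (ler_normD _ _))//.
have -> : 2 * K * `|y - x| * `|y - x| = 2 * K * (y - x) ^+ 2.
  by rewrite -mulrA -normrM -expr2 ger0_norm ?sqr_ge0.
have := fd _ _ xuv yuv; have := fd _ _ yuv xuv.
have -> : (x - y) ^+ 2 = (y - x) ^+ 2 by ring.
lra.
Qed.

Lemma jet_on_ext K u v f d f' d' :
  (forall x, u <= x <= v -> f' x = f x /\ d' x = d x) ->
  jet_on K u v f d -> jet_on K u v f' d'.
Proof.
by move=> e fd x y xuv yuv; have [-> ->] := e x xuv; have [-> _] := e y yuv; exact: fd.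
Qed.

(** For [x <= m <= y] the errors over [[x, m]] and [[m, y]] and the cross term
[(d m - d x) (y - m)] are bounded by [K (m - x)^2], [K (y - m)^2] and
[2 K (m - x) (y - m)], which sum up to exactly [K (y - x)^2]: no constant is lost,
hence none is lost in infinitely many gluings. *)
Lemma jet_on_glue K u m v f d :
  jet_on K u m f d -> jet_on K m v f d -> jet_on K u v f d.
Proof.
move=> fd1 fd2.
have key x y : `|d m - d x| <= 2 * K * `|m - x| ->
    `|f m - f x - d x * (m - x)| <= K * (m - x) ^+ 2 ->
    `|f y - f m - d m * (y - m)| <= K * (y - m) ^+ 2 ->
    0 <= (m - x) * (y - m) ->
    `|f y - f x - d x * (y - x)| <= K * (y - x) ^+ 2.
  move=> h1 h2 h3 h4.
  have -> : f y - f x - d x * (y - x) = (f m - f x - d x * (m - x)) +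
    (f y - f m - d m * (y - m)) + (d m - d x) * (y - m) by ring.
  have h5 : `|(d m - d x) * (y - m)| <= 2 * K * ((m - x) * (y - m)).
    rewrite -(ger0_norm h4) !normrM !mulrA ler_wpM2r//.
  have := ler_normD (f m - f x - d x * (m - x) + (f y - f m - d m * (y - m)))
    ((d m - d x) * (y - m)).
  have := ler_normD (f m - f x - d x * (m - x)) (f y - f m - d m * (y - m)).
  nra.
move=> x y /andP[ux xv] /andP[uy yv].
have [xm|mx] := leP x m; have [ym|my] := leP y m.
- by apply: fd1; rewrite ?ux ?uy ?xm ?ym.
- apply: key; [apply: (jet_on_lip fd1)|apply: fd1|apply: fd2|]; nra.
- apply: key; [apply: (jet_on_lip fd2)|apply: fd2|apply: fd1|]; nra.
- by apply: fd2; lra.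
Qed.

(** No point of [[0, 1]] is isolated, so relative derivatives are unique limits. *)
Lemma slope_filter01 x : 0 <= x <= 1 -> ProperFilter (within `[0, 1] x^').
Proof.
move=> x01; apply: Build_ProperFilter_ex => P.
rewrite /within/= => -[e /= e0 h].
pose r := Num.min (e / 2) (1/2).
have r0 : 0 < r by rewrite lt_min; apply/andP; split; lra.
have re : r < e by rewrite gt_min; apply/orP; left; lra.
have r2 : r <= 1/2 by rewrite ge_min lexx orbT.
have [x2|x2] := leP x (1/2).
  exists (x + r); apply: h; rewrite /ball_/= ?in_itv/=; [|by rewrite gt_eqF//; lra|lra].
  by rewrite opprD addrA subrr sub0r normrN gtr0_norm.
exists (x - r); apply: h; rewrite /ball_/= ?in_itv/=; [|by rewrite lt_eqF//; lra|lra].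
by rewrite opprB addrCA subrr addr0 gtr0_norm.
Qed.

Lemma jet_on_ge0 K (f d : R -> R) : jet_on K 0 1 f d -> 0 <= K.
Proof.
move=> fd; have := fd 0 1; rewrite !lexx !ler01 subr0 expr1n !mulr1 => /(_ isT isT).
exact: le_trans (normr_ge0 _).
Qed.

Lemma jet_slope K (f d : R -> R) x : jet_on K 0 1 f d -> 0 <= x <= 1 ->
  slope01 f x --> d x.
Proof.
move=> fd x01; have := slope_filter01 x01 => PF.
have K0 := jet_on_ge0 fd.
rewrite /slope01; apply/cvgrPdist_lt => e e0; rewrite !near_withinE.
have eK : 0 < e / (K + 1) by rewrite divr_gt0//; lra.
exists (e / (K + 1)) => //= y; rewrite /ball_/= => xye yx; rewrite in_itv/= => y01.
have yx0 : 0 < `|y - x| by rewrite normr_gt0 subr_eq0.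
rewrite -(ltr_pM2r yx0) -normrM mulrBl divfK ?subr_eq0//.
rewrite -normrN opprB; apply: le_lt_trans (fd x y x01 y01) _.
rewrite -[_ ^+ 2]ger0_norm ?sqr_ge0// normrX expr2 mulrA ltr_pM2r//.
move: xye; rewrite distrC ltr_pdivlMr; last lra.
nra.
Qed.

Lemma jet_D01 K (f d : R -> R) x : jet_on K 0 1 f d -> 0 <= x <= 1 ->
  D01 f x = d x.
Proof.
move=> fd x01; have PF := slope_filter01 x01.
by apply: cvg_lim => //; exact: jet_slope fd x01.
Qed.

Lemma jet_C1Lip K (f d : R -> R) : jet_on K 0 1 f d -> C1Lip_01 f.
Proof.
move=> fd.
have lip : [lipschitz D01 f x | x in `[0, 1]].
  apply: (@klipschitzW _ _ _ (2 * K)).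
    apply: (@globally_properfilter _ _ (0, 0)).
    by split; rewrite /= in_itv/= lexx ler01.
  move=> [x y] /= []; rewrite !in_itv/= => x01 y01.
  rewrite !(jet_D01 fd)//; exact: (jet_on_lip fd y01 x01).
split => //; split=> [x|].
  by rewrite in_itv/= => x01; apply/cvg_ex; exists (d x); exact: jet_slope fd x01.
have K0 := jet_on_ge0 fd.
apply/subspace_continuousP => x; rewrite /= in_itv/= => x01.
rewrite /slope01; apply/cvgrPdist_lt => e e0; rewrite !near_withinE.
have eK : 0 < e / (2 * K + 1) by rewrite divr_gt0//; lra.
exists (e / (2 * K + 1)) => //= y; rewrite /ball_/= => xye; rewrite in_itv/= => y01.
rewrite /from_subspace !(jet_D01 fd)//.
apply: le_lt_trans (jet_on_lip fd y01 x01) _.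
move: xye; rewrite ltr_pdivlMr; last lra.
have := normr_ge0 (x - y); nra.
Qed.

End Jets.

(** * One step of inverse renormalization *)

Section Maps.
Context {R : realType}.
Implicit Types (x e : R).

(** The break points are [p], [q] and [1 - b]. *)
Definition piecewise (A B C D : R) x : R :=
  if x < 12/25 then A else if x <= 17/25 then B else if x <= 24/25 then C else D.

(** The orientation reversing affine map of [J = [12/25, 17/25]] onto [[0, 1]]. *)
Definition zoom x : R := 5 * (17/25 - x).

(** The affine map of the gap [[17/25, 24/25]] onto [[0, 1]]. *)
Definition gap_coord x : R := (x - 17/25) * (25/7).

(** The cubic is the Hermite interpolation, in the coordinate [gap_coord], of the
values [612/625] and [1/5] with the slopes in [x] being [- 1/5] and [- 5].  The
bump vanishes to second order at both ends, so [e] changes no end condition. *)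
Definition gap e (s : R) : R :=
  (612 - 35 * s - 516 * s ^+ 2 + 64 * s ^+ 3 + e * (s * (1 - s)) ^+ 2) / 625.

Definition dgap e (s : R) : R :=
  (- 35 - 1032 * s + 192 * s ^+ 2 + e * (2 * (s * (1 - s)) * (1 - 2 * s))) / 625.

(** The inverse branch of renormalization with gap parameter [e]. *)
Definition unrenorm e (g : R -> R) x : R :=
  piecewise (12/25 + x) (24/25 + g (zoom x) / 25) (gap e (gap_coord x)) (5 * (1 - x)) x.

Definition dunrenorm e (dg : R -> R) x : R :=
  piecewise 1 (- (dg (zoom x) / 5)) (dgap e (gap_coord x) * (25/7)) (- 5) x.

Lemma jet_gap e : 0 <= e <= 1 ->
  jet_on 100 (17/25) (24/25) (gap e \o gap_coord)
    (fun x => dgap e (gap_coord x) * (25/7)).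
Proof.
move=> e01 x y xI yI /=; set s := gap_coord x; set t := gap_coord y.
have s01 : 0 <= s <= 1 by rewrite /s /gap_coord; lra.
have t01 : 0 <= t <= 1 by rewrite /t /gap_coord; lra.
have yx : y - x = (t - s) * (7/25) by rewrite /s /t /gap_coord; field.
clearbody s t; rewrite yx.
(* The error of a polynomial is divisible by [(t - s) ^ 2]; [Q] is the quotient. *)
pose Q := (- 516 + 64 * (t + 2 * s) +
  e * (t ^+ 2 + 2 * t * s + 3 * s ^+ 2 + 1 - 2 * t - 4 * s)) / 625.
have -> : gap e t - gap e s - dgap e s * (25 / 7) * ((t - s) * (7 / 25)) =
   Q * (t - s) ^+ 2 by rewrite /gap /dgap /Q; field.
have -> : 100 * ((t - s) * (7 / 25)) ^+ 2 = (196/25) * (t - s) ^+ 2 :> R by field.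
rewrite normrM [X in _ * X]ger0_norm ?sqr_ge0// ler_wpM2r ?sqr_ge0// ler_norml.
have h0 : -10 <= t^+2 + 2 * t * s + 3 * s^+2 + 1 - 2 * t - 4 * s <= 10 by nra.
rewrite /Q; nra.
Qed.

(** The values and slopes of [g] at [0] and [1] are those of a map that is itself
of the form [unrenorm e g], and they make the pieces match to first order.  On
[J] the error of [g] is divided by [25] while [(y - x)^2] is multiplied by [25]:
the constant is preserved.  The value [100] exceeds half the second derivative on
the gap. *)
Lemma jet_unrenorm e g dg : 0 <= e <= 1 -> jet_on 100 0 1 g dg ->
  g 0 = 12/25 -> dg 0 = 1 -> g 1 = 0 -> dg 1 = - 5 ->
  jet_on 100 0 1 (unrenorm e g) (dunrenorm e dg).
Proof.
move=> e01 gj g0 dg0 g1 dg1.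
apply: (@jet_on_glue _ _ _ (12/25)); last apply: (@jet_on_glue _ _ _ (17/25));
  last apply: (@jet_on_glue _ _ _ (24/25)).
- apply: (@jet_on_ext _ _ _ _ (fun x => 12/25 + x) (fun=> 1)).
    move=> x xI; rewrite /unrenorm /dunrenorm /piecewise; case: ltP => // xge.
    have -> : x = 12/25 by lra.
    have -> : zoom (12/25) = 1 by rewrite /zoom; field.
    by rewrite g1 dg1 !ifT; [split; field|lra..].
  move=> x y _ _; rewrite (_ : _ - _ = 0) ?normr0; last by ring.
  by rewrite mulr_ge0// sqr_ge0.
- apply: (@jet_on_ext _ _ _ _ (fun x => 24/25 + g (zoom x) / 25)
    (fun x => - (dg (zoom x) / 5))).
    move=> x xI; rewrite /unrenorm /dunrenorm /piecewise.
    by case: ltP => ?; [lra|rewrite !ifT//; lra].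
  move=> x y xI yI.
  have := gj (zoom x) (zoom y).
  have -> : (zoom y - zoom x) = -5 * (y - x) by rewrite /zoom; ring.
  have -> : 24 / 25 + g (zoom y) / 25 - (24 / 25 + g (zoom x) / 25) -
   - (dg (zoom x) / 5) * (y - x) =
    (g (zoom y) - g (zoom x) - dg (zoom x) * (- 5 * (y - x))) / 25 by field.
  rewrite normrM normfV (ger0_norm (_ : 0 <= 25))// => h.
  have /h {}h : 0 <= zoom x <= 1 by rewrite /zoom; lra.
  have /h {}h : 0 <= zoom y <= 1 by rewrite /zoom; lra.
  lra.
- apply: jet_on_ext (jet_gap e01) => x xI; rewrite /unrenorm /dunrenorm /piecewise.
  case: ltP => ?; first lra.
  case: leP => ?; last by rewrite !ifT//; lra.
  have -> : x = 17/25 by lra.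
  have -> : zoom (17/25) = 0 by rewrite /zoom; field.
  by rewrite g0 dg0 /= /gap /dgap /gap_coord; split; field.
- apply: (@jet_on_ext _ _ _ _ (fun x => 5 * (1 - x)) (fun=> - 5)).
    move=> x xI; rewrite /unrenorm /dunrenorm /piecewise; case: ltP => ?; first lra.
    case: leP => ?; first lra; case: leP => // ?.
    have -> : x = 24/25 by lra.
    by rewrite /gap /dgap /gap_coord; split; field.
  move=> x y _ _; rewrite (_ : _ - _ = 0) ?normr0; last by ring.
  by rewrite mulr_ge0// sqr_ge0.
Qed.

End Maps.

(** * Infinitely many steps *)

Section Limit.
Context {R : realType}.
Implicit Types (w v : nat -> R) (x y e : R).

Definition symshift w : nat -> R := fun i => w i.+1.

(** The bottom stage is the Hermite cubic with the values and slopes at [0] and [1]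
that [jet_unrenorm] requires. *)
Fixpoint stage N w : R -> R :=
  if N is M.+1 then unrenorm (w 0) (stage M (symshift w))
  else fun x => 12/25 + x + 39/25 * x ^+ 2 - 76/25 * x ^+ 3.

Fixpoint dstage N w : R -> R :=
  if N is M.+1 then dunrenorm (w 0) (dstage M (symshift w))
  else fun x => 1 + 78/25 * x - 228/25 * x ^+ 2.

(** The value [0] outside [[0, 1]] is the convention for maps on [[0, 1]]. *)
Definition tower w x : R := if x \in `[0, 1] then lim (stage N w x @[N --> \oo]) else 0.
Definition dtower w x : R := lim (dstage N w x @[N --> \oo]).

Lemma unrenorm_lo e g x : x < 12/25 -> unrenorm e g x = 12/25 + x.
Proof. by rewrite /unrenorm /piecewise => ->. Qed.

Lemma unrenorm_mid e g x : 12/25 <= x <= 17/25 -> unrenorm e g x = 24/25 + g (zoom x) / 25.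
Proof. by move=> /andP[? h]; rewrite /unrenorm /piecewise ltNge h; case: leP => //; lra. Qed.

Lemma unrenorm_hi e g g' x : 17/25 < x -> unrenorm e g x = unrenorm e g' x.
Proof. by move=> h; rewrite /unrenorm /piecewise; case: ltP => [|_]; [lra|rewrite leNgt h]. Qed.

Lemma dunrenorm_lo e g x : x < 12/25 -> dunrenorm e g x = 1.
Proof. by rewrite /dunrenorm /piecewise => ->. Qed.

Lemma dunrenorm_mid e g x : 12/25 <= x <= 17/25 -> dunrenorm e g x = - (g (zoom x) / 5).
Proof. by move=> /andP[? h]; rewrite /dunrenorm /piecewise ltNge h; case: leP => //; lra. Qed.

Lemma dunrenorm_hi e g g' x : 17/25 < x -> dunrenorm e g x = dunrenorm e g' x.
Proof. by move=> h; rewrite /dunrenorm /piecewise; case: ltP => [|_]; [lra|rewrite leNgt h]. Qed.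

Lemma zoom01 x : 12/25 <= x <= 17/25 -> 0 <= zoom x <= 1.
Proof. by rewrite /zoom; lra. Qed.

Lemma zoom_center : zoom (17/30) = 17/30 :> R.
Proof. by rewrite /zoom; field. Qed.

Lemma expn5_lt e : 0 < e -> exists k : nat, (1/5) ^+ k < e.
Proof.
move=> e0; have /cvgr0Pnorm_lt/(_ e e0)[k _ /(_ k (leqnn k))] :
    (fun k => (1/5 : R) ^+ k) @ \oo --> 0.
  by apply: cvg_expr; rewrite ger0_norm; lra.
rewrite ger0_norm; first by exists k.
by apply: exprn_ge0; lra.
Qed.

(** Every point of [[0, 1]] except the fixed point [17/30] of [zoom] leaves [J]
after finitely many zooms, since [zoom] multiplies the distance to it by [5]. *)
Lemma zoom_ind (P : (nat -> R) -> R -> Prop) :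
  (forall w x, 0 <= x <= 1 -> x < 12/25 \/ 17/25 < x -> P w x) ->
  (forall w x, 12/25 <= x <= 17/25 -> P (symshift w) (zoom x) -> P w x) ->
  forall w x, 0 <= x <= 1 -> x != 17/30 -> P w x.
Proof.
move=> Pout Pin w x x01 xc.
have key k : forall v y, 0 <= y <= 1 -> (1/5) ^+ k.+1 < `|y - 17/30| -> P v y.
  elim: k => [|k IH] v y y01 yk.
    (* All of [J] is within distance [1/5] of the fixed point. *)
    by apply: Pout => //; move: yk; rewrite expr1 ltr_normr => /orP[?|?];
      [right|left]; lra.
  have [?|?] := ltP y (12/25); first by apply: Pout => //; left.
  have [?|?] := ltP (17/25) y; first by apply: Pout => //; right.
  have yJ : 12/25 <= y <= 17/25 by lra.
  apply: Pin => //; apply: IH; first exact: zoom01.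
  have -> : zoom y - 17/30 = - 5 * (y - 17/30) by rewrite /zoom; field.
  rewrite normrM normrN (ger0_norm (_ : 0 <= 5))//.
  by move: yk; rewrite [_ ^+ k.+2]exprS; set r := _ ^+ k.+1; lra.
have [k hk] : exists k : nat, (1/5) ^+ k < `|x - 17/30|.
  by apply: expn5_lt; rewrite normr_gt0 subr_eq0.
apply: (key k) => //; apply: le_lt_trans hk.
by rewrite exprS ler_piMl// ?exprn_ge0; lra.
Qed.

(** Away from the fixed point, only finitely many levels are ever consulted. *)
Lemma stage_stable w x : 0 <= x <= 1 -> x != 17/30 -> exists N0, forall N,
  stage (N0 + N) w x = stage N0 w x /\ dstage (N0 + N) w x = dstage N0 w x.
Proof.
move: w x; apply: zoom_ind => w x.
  move=> x01 xo; exists 1%N => N; rewrite add1n /=.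
  case: xo => xo; first by rewrite !(unrenorm_lo, dunrenorm_lo).
  rewrite -(unrenorm_hi _ (stage 0 (symshift w)))//.
  by rewrite -(dunrenorm_hi _ (dstage 0 (symshift w))).
move=> xJ [N0 h]; exists N0.+1 => N; rewrite addSn /= !(unrenorm_mid, dunrenorm_mid)//.
by have [-> ->] := h N.
Qed.

Lemma stage_center N w : stage N w (17/30) = 1 - (1/25) ^+ N * (1 - stage 0 w (17/30)).
Proof.
elim: N w => [|N IH] w; first by rewrite expr0 mul1r opprB addrC subrK.
rewrite [LHS]/= unrenorm_mid; last lra.
by rewrite zoom_center IH exprS /=; field.
Qed.

Lemma dstage_center N w : dstage N w (17/30) = (- (1/5)) ^+ N * dstage 0 w (17/30).
Proof.
elim: N w => [|N IH] w; first by rewrite expr0 mul1r.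
rewrite [LHS]/= dunrenorm_mid; last lra.
by rewrite zoom_center IH exprS /=; field.
Qed.

Lemma cvg_stage_center w : stage N w (17/30) @[N --> \oo] --> (1 : R).
Proof.
under eq_fun do rewrite stage_center.
have : (1 - (1/25) ^+ N * (1 - stage 0 w (17/30))) @[N --> \oo] -->
    (1 - 0 * (1 - stage 0 w (17/30)) : R).
  apply: cvgB; first exact: cvg_cst.
  by apply: cvgMl; apply: cvg_expr; rewrite ger0_norm; lra.
by rewrite mul0r subr0.
Qed.

Lemma cvg_dstage_center w : dstage N w (17/30) @[N --> \oo] --> (0 : R).
Proof.
under eq_fun do rewrite dstage_center.
have : ((- (1/5)) ^+ N * dstage 0 w (17/30)) @[N --> \oo] -->
    (0 * dstage 0 w (17/30) : R).
  by apply: cvgMl; apply: cvg_expr; rewrite normrN ger0_norm; lra.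
by rewrite mul0r.
Qed.

Lemma is_cvg_stage w x : 0 <= x <= 1 ->
  cvgn (fun N => stage N w x) /\ cvgn (fun N => dstage N w x).
Proof.
move=> x01; have [->|xc] := eqVneq x (17/30).
  by split; apply: cvgP; [exact: cvg_stage_center|exact: cvg_dstage_center].
have [N0 h] := stage_stable w x01 xc.
by split; apply/cvg_ex; [exists (stage N0 w x)|exists (dstage N0 w x)];
  apply: cvg_near_cst; exists N0 => // N /= /subnKC <-; have [? ?] := h (N - N0)%N.
Qed.

Lemma in01 x : (x \in `[0, 1]) = (0 <= x <= 1).
Proof. by rewrite in_itv. Qed.

Lemma cvg_tower w x : 0 <= x <= 1 -> stage N w x @[N --> \oo] --> tower w x.
Proof. by move=> x01; rewrite /tower in01 x01; have [] := is_cvg_stage w x01. Qed.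

Lemma cvg_dtower w x : 0 <= x <= 1 -> dstage N w x @[N --> \oo] --> dtower w x.
Proof. by move=> x01; have [] := is_cvg_stage w x01. Qed.

Lemma tower_center w : tower w (17/30) = 1.
Proof.
rewrite /tower in01 ifT; last lra.
by apply/cvg_lim => //; exact: cvg_stage_center.
Qed.

Lemma dtower_center w : dtower w (17/30) = 0.
Proof. by apply/cvg_lim => //; exact: cvg_dstage_center. Qed.

(** The relation between consecutive stages passes to the limit. *)
Lemma towerE w x : 0 <= x <= 1 -> tower w x = unrenorm (w 0) (tower (symshift w)) x.
Proof.
move=> x01; have h : stage N.+1 w x @[N --> \oo] --> tower w x.
  by rewrite (cvg_shiftS (fun N => stage N w x)); exact: cvg_tower.
suff h' : stage N.+1 w x @[N --> \oo] --> unrenorm (w 0) (tower (symshift w)) x.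
  by rewrite -(cvg_lim _ h)// (cvg_lim _ h').
rewrite /=; have [xl|xl] := ltP x (12/25).
  by under eq_fun do rewrite unrenorm_lo//; rewrite unrenorm_lo//; exact: cvg_cst.
have [xh|xh] := ltP (17/25) x.
  under eq_fun do rewrite (unrenorm_hi _ _ (tower (symshift w)) xh).
  exact: cvg_cst.
have xJ : 12/25 <= x <= 17/25 by lra.
under eq_fun do rewrite unrenorm_mid//; rewrite unrenorm_mid//.
apply: cvgD; first exact: cvg_cst.
by apply: cvgMl; apply: cvg_tower; exact: zoom01.
Qed.

Lemma dtowerE w x : 0 <= x <= 1 -> dtower w x = dunrenorm (w 0) (dtower (symshift w)) x.
Proof.
move=> x01; have h : dstage N.+1 w x @[N --> \oo] --> dtower w x.
  by rewrite (cvg_shiftS (fun N => dstage N w x)); exact: cvg_dtower.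
suff h' : dstage N.+1 w x @[N --> \oo] --> dunrenorm (w 0) (dtower (symshift w)) x.
  by rewrite -(cvg_lim _ h)// (cvg_lim _ h').
rewrite /=; have [xl|xl] := ltP x (12/25).
  by under eq_fun do rewrite dunrenorm_lo//; rewrite dunrenorm_lo//; exact: cvg_cst.
have [xh|xh] := ltP (17/25) x.
  under eq_fun do rewrite (dunrenorm_hi _ _ (dtower (symshift w)) xh).
  exact: cvg_cst.
have xJ : 12/25 <= x <= 17/25 by lra.
under eq_fun do rewrite dunrenorm_mid//; rewrite dunrenorm_mid//.
by apply: cvgN; apply: cvgMl; apply: cvg_dtower; exact: zoom01.
Qed.

(** For such parameters [gap] is decreasing with values in [[0, 1]]. *)
Definition admissible w := forall i, 0 <= w i <= 1.

Lemma admissible_symshift w : admissible w -> admissible (symshift w).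
Proof. by move=> h i; exact: h. Qed.

Lemma stage_ends N w :
  [/\ stage N w 0 = 12/25, dstage N w 0 = 1, stage N w 1 = 0 & dstage N w 1 = - 5].
Proof.
case: N => [|N] /=; first by split; field.
rewrite unrenorm_lo 1?dunrenorm_lo /unrenorm /dunrenorm /piecewise; [|lra..].
by rewrite !ifF; [split; field|lra..].
Qed.

Lemma jet_stage N w : admissible w -> jet_on 100 0 1 (stage N w) (dstage N w).
Proof.
elim: N w => [|N IH] w aw /=.
  move=> x y xI yI.
  rewrite (_ : _ - _ = (39/25 - 76/25 * (y + 2 * x)) * (y - x) ^+ 2); last by field.
  by rewrite normrM [X in _ * X]ger0_norm ?sqr_ge0// ler_wpM2r ?sqr_ge0// ler_norml; lra.
have [? ? ? ?] := stage_ends N (symshift w).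
by apply: jet_unrenorm => //; apply: IH; exact: admissible_symshift.
Qed.

Lemma jet_tower w : admissible w -> jet_on 100 0 1 (tower w) (dtower w).
Proof.
move=> aw x y xI yI.
have h : `|stage N w y - stage N w x - dstage N w x * (y - x)| @[N --> \oo] -->
    `|tower w y - tower w x - dtower w x * (y - x)|.
  apply: cvg_norm; apply: cvgB; first by apply: cvgB; exact: cvg_tower.
  by apply: cvgMl; exact: cvg_dtower.
rewrite -(cvg_lim _ h)//; apply: limr_le; first exact: cvgP h.
by apply: nearW => N; exact: jet_stage.
Qed.

(** The polynomial [487 - 35 s - 516 s^2 + 64 s^3] vanishes at [s = 1], where the
lower bound is attained; factoring out [1 - s] exhibits its sign. *)
Lemma gap_range e x : 0 <= e <= 1 -> 17/25 <= x <= 24/25 ->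
  1/5 <= gap e (gap_coord x) <= 612/625.
Proof.
move=> e01 xI; have : 0 <= gap_coord x <= 1 by rewrite /gap_coord; lra.
move: (gap_coord x) => s s01; rewrite /gap.
have s2 : 0 <= s ^+ 2 <= s by nra.
have s3 : 0 <= s ^+ 3 <= s ^+ 2 by rewrite (exprS s 2); move: (s ^+ 2) s2 => u; nra.
have b0 : 0 <= s * (1 - s) <= 1 by nra.
have b1 : 0 <= (s * (1 - s)) ^+ 2 <= s * (1 - s).
  by move: (s * (1 - s)) b0 => u; nra.
have b2 : 0 <= e * (s * (1 - s)) ^+ 2 <= (s * (1 - s)) ^+ 2.
  by move: (_ ^+ 2) b1 => u; nra.
have b3 : 0 <= (1 - s) * (487 + 452 * s - 64 * s ^+ 2).
  by apply: mulr_ge0; lra.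
have b4 : (1 - s) * (487 + 452 * s - 64 * s ^+ 2) =
  487 - 35 * s - 516 * s ^+ 2 + 64 * s ^+ 3 by ring.
lra.
Qed.

Lemma dgap_lt0 e x : 0 <= e <= 1 -> 17/25 <= x <= 24/25 ->
  dgap e (gap_coord x) < 0.
Proof.
move=> e01 xI; have : 0 <= gap_coord x <= 1 by rewrite /gap_coord; lra.
move: (gap_coord x) => s s01; rewrite /dgap.
have s2 : 0 <= s ^+ 2 <= s by nra.
have b0 : 0 <= s * (1 - s) <= 1 by nra.
have b1 : -2 <= 2 * (s * (1 - s)) * (1 - 2 * s) <= 2 by nra.
have b2 : -2 <= e * (2 * (s * (1 - s)) * (1 - 2 * s)) <= 2.
  by move: (2 * _ * _) b1 => u; nra.
lra.
Qed.

Lemma tower_lo w x : 0 <= x <= 12/25 -> tower w x = 12/25 + x.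
Proof.
move=> xI; rewrite towerE; last lra.
have [?|?] := ltP x (12/25); first by rewrite unrenorm_lo.
have -> : x = 12/25 by lra.
rewrite unrenorm_mid; last lra.
have -> : zoom (12/25) = 1 :> R by rewrite /zoom; field.
rewrite towerE; last lra.
by rewrite /unrenorm /piecewise !ifF; [field|lra..].
Qed.

Lemma tower_mid w x : 12/25 <= x <= 17/25 ->
  tower w x = 24/25 + tower (symshift w) (zoom x) / 25.
Proof. by move=> xI; rewrite towerE ?unrenorm_mid//; lra. Qed.

Lemma tower_gap w x : 17/25 < x <= 24/25 -> tower w x = gap (w 0) (gap_coord x).
Proof.
move=> xI; rewrite towerE /unrenorm /piecewise; last lra.
by case: ltP => [|_]; [lra|case: leP => [|_]; [lra|case: leP => // ?; lra]].
Qed.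

Lemma tower_hi w x : 24/25 <= x <= 1 -> tower w x = 5 * (1 - x).
Proof.
move=> xI; have [?|?] := ltP (24/25) x.
  by rewrite towerE /unrenorm /piecewise ?ifF//; lra.
have -> : x = 24/25 by lra.
by rewrite tower_gap ?/gap ?/gap_coord; [field|lra].
Qed.

Lemma tower_range w x : admissible w -> 0 <= x <= 1 -> 0 <= tower w x <= 1.
Proof.
move=> aw x01; have [->|xc] := eqVneq x (17/30); first by rewrite tower_center; lra.
move: w x x01 xc aw; apply: zoom_ind => w x.
  move=> x01 [xl|xh] aw; first by rewrite tower_lo; lra.
  have [?|?] := ltP (24/25) x; first by rewrite tower_hi; lra.
  rewrite tower_gap; last lra.
  by have := @gap_range (w 0) x (aw 0%N); lra.
by move=> xJ IH aw; rewrite tower_mid//; have := IH (admissible_symshift aw); lra.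
Qed.

(** Outside [J] the slope is explicit; inside, a zoom divides it by [- 5]. *)
Lemma dtower_neq0 w x : admissible w -> 0 <= x <= 1 -> x != 17/30 -> dtower w x != 0.
Proof.
move=> aw x01 xc; move: w x x01 xc aw; apply: zoom_ind => w x.
  move=> x01 [xl|xh] aw; rewrite dtowerE//; first by rewrite dunrenorm_lo// oner_neq0.
  rewrite /dunrenorm /piecewise; case: ltP => [|_]; first lra.
  case: leP => [|_]; first lra.
  case: leP => ?; last by rewrite oppr_eq0 pnatr_eq0.
  have := @dgap_lt0 (w 0) x (aw 0%N); lra.
move=> xJ IH aw; rewrite dtowerE ?dunrenorm_mid//; last lra.
by rewrite oppr_eq0 mulf_neq0 ?invr_eq0 ?pnatr_eq0//; exact: IH (admissible_symshift aw).
Qed.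

Lemma dtower_0 w : dtower w 0 = 1.
Proof. by rewrite dtowerE ?dunrenorm_lo//; lra. Qed.

Lemma dtower_bound w x : admissible w -> 0 <= x <= 1 -> `|dtower w x| <= 201.
Proof.
move=> aw x01; have := jet_on_lip (jet_tower aw) (_ : 0 <= 0 <= 1) x01.
rewrite lexx ler01 dtower_0 => /(_ isT); rewrite !ler_norml => h.
have := ger0_norm (_ : 0 <= x - 0); have : 0 <= x - 0 by lra.
by move=> x0 /(_ x0) h1; move: h; rewrite h1; lra.
Qed.

(** Each common parameter is one application of the same [unrenorm], which
contracts values by [1/25] and derivatives by [1/5]; the constant [402] is twice
the bound of [dtower_bound]. *)
Lemma tower_close N w v x : admissible w -> admissible v ->
  (forall i, (i < N)%N -> w i = v i) -> 0 <= x <= 1 ->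
  `|tower w x - tower v x| <= (1/5) ^+ N /\ `|dtower w x - dtower v x| <= 402 * (1/5) ^+ N.
Proof.
elim: N w v x => [|N IH] w v x aw av wv x01.
  rewrite expr0 mulr1; split.
    by have := tower_range aw x01; have := tower_range av x01; rewrite ler_norml; lra.
  have := dtower_bound aw x01; have := dtower_bound av x01.
  by rewrite !ler_norml; lra.
have p5 : 0 <= (1/5 : R) ^+ N by apply: exprn_ge0; lra.
rewrite exprS !towerE// !dtowerE// -(wv 0%N)//.
have [xl|xl] := ltP x (12/25).
  by rewrite !unrenorm_lo// !dunrenorm_lo// !subrr normr0; split; lra.
have [xh|xh] := ltP (17/25) x.
  rewrite (unrenorm_hi _ _ (tower (symshift v)) xh).
  rewrite (dunrenorm_hi _ _ (dtower (symshift v)) xh).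
  by rewrite !subrr normr0; split; lra.
have xJ : 12/25 <= x <= 17/25 by lra.
rewrite !unrenorm_mid// !dunrenorm_mid//.
have [] := IH _ _ _ (admissible_symshift aw) (admissible_symshift av) _ (zoom01 xJ).
  by move=> i iN; exact: wv.
rewrite !ler_norml; lra.
Qed.

(** The point [41/50] is the middle of the gap, where the bump is largest; its
preimage under [i] zooms lies in the gap of level [i]. *)
Lemma symbol_read i : exists x k : R, [/\ 0 <= x <= 1, 0 < k & forall w v,
  `|tower w x - tower v x| = k * `|w i - v i|].
Proof.
elim: i => [|i [x [k [x01 k0 IH]]]].
  have k0 : 0 < (1/100 : R) ^+ 2 by apply: exprn_gt0; lra.
  exists (41/50), ((1/100) ^+ 2); split=> [|//|w v]; first lra.
  rewrite !tower_gap; [|lra..].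
  have -> : gap_coord (41/50) = 1/2 :> R by rewrite /gap_coord; field.
  have -> : gap (w 0) (1/2) - gap (v 0) (1/2) = (1/100) ^+ 2 * (w 0 - v 0).
    by rewrite /gap; field.
  by rewrite normrM (gtr0_norm k0).
have xJ : 12/25 <= 17/25 - x / 5 <= 17/25 by lra.
exists (17/25 - x/5), (k/25); split=> [||w v]; [lra..|].
rewrite (tower_mid w xJ) (tower_mid v xJ).
have -> : zoom (17/25 - x/5) = x by rewrite /zoom; field.
have := IH (symshift w) (symshift v); rewrite /symshift => {}IH.
rewrite (_ : _ - _ = (tower (symshift w) x - tower (symshift v) x) / 25); last by field.
rewrite normrM IH normfV (ger0_norm (_ : 0 <= 25)); last by rewrite ler0n.
by rewrite mulrAC.
Qed.

End Limit.

(** * The towers are renormalizable *)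

Section Unimodal.
Context {R : realType}.
Implicit Types (w : nat -> R) (x : R).

Lemma tower_out w x : x \notin `[0, 1] -> tower w x = 0.
Proof. by rewrite /tower => /negbTE ->. Qed.

Lemma D01_tower w x : admissible w -> 0 <= x <= 1 -> D01 (tower w) x = dtower w x.
Proof. by move=> aw; exact: jet_D01 (jet_tower aw). Qed.

Lemma tower_unimodal w : admissible w -> unimodal_with (tower w) (17/30).
Proof.
move=> aw; split.
- by have [] := jet_C1Lip (jet_tower aw).
- by move=> x; rewrite !in_itv/=; exact: tower_range.
- by move=> x; exact: tower_out.
- apply/seteqP; split=> x /=.
    rewrite in_itv/= => -[x01]; rewrite D01_tower// => dx.
    apply/eqP; apply: contraPT dx => xc; apply/eqP; exact: dtower_neq0.
  move=> ->; rewrite in_itv/= D01_tower//; last lra.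
  by rewrite dtower_center; split=> //; lra.
- by rewrite tower_center tower_hi; [split; [|ring]|lra].
Qed.

Lemma tower_0 w : tower w 0 = 12/25.
Proof. by rewrite tower_lo; lra. Qed.

Lemma iter4_tower w : iter 4 (tower w) 0 = 17/25.
Proof.
rewrite /= tower_0 (@tower_lo _ w (12/25)); last lra.
rewrite (@tower_hi _ w (12/25 + 12/25)); last lra.
by rewrite tower_lo; lra.
Qed.

Lemma Jtrip_tower w : Jtrip (tower w) = `[12/25, 17/25]%classic.
Proof. by rewrite /Jtrip iter4_tower tower_0. Qed.

(** The images of [J] in terms of the next tower: reading off the three
intervals, and that the return map to [J] is affinely conjugate to that tower. *)
Lemma tower_cycle w x : admissible w -> 12/25 <= x <= 17/25 ->
  let u := tower (symshift w) (zoom x) in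
  [/\ 0 <= u <= 1, tower w x = 24/25 + u/25,
      iter 2 (tower w) x = (1 - u) / 5 &
      iter 3 (tower w) x = 12/25 + (1 - u) / 5].
Proof.
move=> aw xJ /=; have := tower_range (admissible_symshift aw) (zoom01 xJ).
rewrite (tower_mid w xJ); move: (tower _ (zoom x)) => u u01.
have -> : tower w (24/25 + u/25) = (1 - u) / 5.
  by rewrite tower_hi; [field|lra].
by split=> //; rewrite tower_lo//; lra.
Qed.

Lemma tower_dom w : admissible w -> @dom_renorm R (tower w).
Proof.
move=> aw; split.
  split; last exact: jet_C1Lip (jet_tower aw).
  by exists (17/30); exact: tower_unimodal.
exists (17/30); split; first exact: tower_unimodal.
rewrite iter4_tower tower_0 Jtrip_tower.
have J1 y : (tower w @` `[12/25, 17/25]) y -> 24/25 <= y <= 1.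
  move=> [x]; rewrite /= in_itv/= => xJ <-.
  by have [? -> _ _] := tower_cycle aw xJ; lra.
have J2 y : (iter 2 (tower w) @` `[12/25, 17/25]) y -> 0 <= y <= 1/5.
  move=> [x]; rewrite /= in_itv/= => xJ <-.
  by have [? _ + _] := tower_cycle aw xJ; rewrite /= => ->; lra.
have J0 y : `[12/25 : R, 17/25]%classic y -> 12/25 <= y <= 17/25.
  by rewrite /= in_itv.
split; first lra.
- split=> [x|/(_ 0)]; rewrite /= !in_itv/= => h; first lra.
  by have := h _; lra.
- split; rewrite -subset0 => y [/interior_subset h /interior_subset h'].
  + by have := J2 _ h; have := J0 _ h'; lra.
  + by have := J0 _ h; have := J1 _ h'; lra.
  + by have := J2 _ h; have := J1 _ h'; lra.
- split=> x y h h'.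
  + by have := J2 _ h; have := J0 _ h'; lra.
  + by have := J0 _ h; have := J1 _ h'; lra.
  + by have := J2 _ h; have := J1 _ h'; lra.
- move=> _ [x + <-]; rewrite /= !in_itv/= => xJ.
  by have [? _ _] := tower_cycle aw xJ; rewrite /= => ->; lra.
Qed.

Lemma renorm_tower w : admissible w ->
  renorm (tower w : C1space R) = tower (symshift w).
Proof.
move=> aw; apply/funext => x; rewrite /renorm; case: ifPn => [|xn].
  rewrite in_itv/= => x01.
  have xJ : 12/25 <= hJ (tower w) x <= 17/25.
    by rewrite /hJ iter4_tower tower_0; lra.
  rewrite -[LHS]/(hJinv (tower w) (iter 3 (tower w) (hJ (tower w) x))).
  have [_ _ _ ->] := tower_cycle aw xJ.
  have -> : zoom (hJ (tower w) x) = x.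
    by rewrite /hJ iter4_tower tower_0 /zoom; field.
  by rewrite /hJinv iter4_tower tower_0; field.
by rewrite tower_out.
Qed.

End Unimodal.

(** * Sequences of symbols *)

Section Sequences.
Context {n : nat}.

Lemma prefix_near (a : shift_space n) N :
  \forall b \near a, forall i, (i < N)%N -> b i = a i.
Proof.
elim: N => [|N IH]; first by apply: (@filterE _ (nbhs a)) => b i.
have hN : \forall b \near a, b N = a N.
  have /= := @proj_continuous nat (fun=> discrete_topology 'I_n) N a [set a N].
  by apply; exact: discrete_set1.
near=> b => i; rewrite ltnS leq_eqVlt => /orP[/eqP ->|].
  by near: b.
by move: i; near: b.
Unshelve. all: by end_near. Qed.

Lemma cvg_coordinates {T : Type} (F : set_system T) {FF : Filter F}
    (f : T -> shift_space n) (a : shift_space n) :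
  (forall i, \forall x \near F, f x i = a i) -> f @ F --> a.
Proof.
move=> h; apply/cvg_sup => i U [/= V [[B oB <-] Ba] BU].
rewrite nbhs_simpl /=; near=> x; apply: BU; rewrite /= (_ : f x i = a i)//.
by near: x; exact: h.
Unshelve. all: by end_near. Qed.

Lemma full_shift_continuous : continuous (@full_shift n).
Proof.
move=> a; apply: (@cvg_coordinates _ (nbhs a) _ (@full_shift n) (full_shift a)) => i.
by apply: filterS (prefix_near a i.+2) => b; exact.
Qed.

Lemma shift_space_compact : compact [set: shift_space n].
Proof.
have := @tychonoff nat (fun=> discrete_topology 'I_n) (fun=> setT).
rewrite (_ : [set f | _] = setT); last by apply/seteqP; split.
apply=> _; apply: finite_compact; exact: (@finite_finset 'I_n).
Qed.

End Sequences.

(** * Embedding of the full shift and entropy *)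

Section Conjugacy.

Context {R : realType}.
Implicit Types (w v : nat -> R) (x e : R).

Lemma C1_ballE (f g : C1space R) e :
  ball f e g = forall t : `[0, 1]%classic, ball (jet01 f t) e (jet01 g t).
Proof. by []. Qed.

Lemma C1_ball_dist (f g : C1space R) e x : ball f e g -> 0 <= x <= 1 ->
  `|f x - g x| < e.
Proof.
rewrite C1_ballE => fg x01; have xI : x \in `[0, 1]%classic by rewrite inE /= in_itv.
by have [] := fg (SigSub xI).
Qed.

Lemma tower_ball e : 0 < e -> exists N, forall w v,
  admissible w -> admissible v -> (forall i, (i < N)%N -> w i = v i) ->
  ball (tower w : C1space R) e (tower v : C1space R).
Proof.
move=> e0; have [|N hN] := @expn5_lt R (e / 402); first by lra.
have p5 : 0 <= (1/5 : R) ^+ N by apply: exprn_ge0; lra.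
exists N => w v aw av wv; rewrite C1_ballE => t.
have t01 : 0 <= val t <= 1 by have := set_valP t; rewrite /= in_itv.
have [h1 h2] := tower_close aw av wv t01.
by split; rewrite /ball/= ?(D01_tower _ t01)//; lra.
Qed.

Section Words.
Context {n : nat}.

Definition word (a : shift_space n) : nat -> R :=
  fun k => (nat_of_ord (a k))%:R / n%:R.

Definition code (a : shift_space n) : C1space R := tower (word a).

Lemma word_admissible a : admissible (word a).
Proof.
move=> i; have n0 : 0 < n%:R :> R by rewrite ltr0n; case: n (a i) => // -[].
rewrite /word divr_ge0 ?ler0n//= ler_pdivrMr// mul1r ler_nat.
exact/ltnW/ltn_ord.
Qed.

Lemma word_dist a b i : a i != b i -> n%:R^-1 <= `|word a i - word b i|.
Proof.
move=> ab; rewrite /word -mulrBl normrM.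
rewrite [X in _ * X]ger0_norm ?invr_ge0 ?ler0n// ler_peMl ?invr_ge0 ?ler0n//.
wlog lt : a b ab / (a i < b i)%N => [hw|].
  have : (nat_of_ord (a i) != nat_of_ord (b i)) by [].
  rewrite neq_ltn => /orP[|] h; first exact: hw.
  by rewrite distrC; apply: hw => //; rewrite eq_sym.
by rewrite distrC -natrB 1?ltnW// ger0_norm ?ler0n// ler1n subn_gt0.
Qed.

(** C^1 closeness at a fixed scale determines the [i]-th symbol: this gives the
injectivity of [code], the continuity of its inverse, and, for [i = 0], the scale
of separation in the entropy estimate. *)
Lemma code_separated i : exists2 e, 0 < e & forall a b,
  ball (code a) e (code b) -> a i = b i.
Proof.
have [x [k [x01 k0 h]]] := @symbol_read R i.
have [n0|n0] := posnP n.
  exists 1 => // a; exfalso; case: (a i) => m; by rewrite n0.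
exists (k * n%:R^-1); first by rewrite mulr_gt0// invr_gt0 ltr0n.
move=> a b /C1_ball_dist/(_ x01); rewrite h ltr_pM2l// => ab.
by apply/eqP; apply: contraTT ab => /word_dist; rewrite -leNgt.
Qed.

Lemma code_inj : injective code.
Proof.
move=> a b ab; apply/funext => i; have [e e0 h] := code_separated i.
by apply: h; rewrite ab; exact: ballxx.
Qed.

Lemma code_continuous : continuous code.
Proof.
move=> a U /nbhs_ballP[e /= e0 eU]; have [N hN] := tower_ball e0.
apply: (@filterS _ (nbhs a) _ _ _ _ (prefix_near a N)) => b ba; apply: eU.
apply: hN; [exact: word_admissible|exact: word_admissible|].
by move=> i /ba bai; rewrite /word bai.
Qed.

Lemma renorm_code a : renorm (code a) = code (full_shift a).
Proof. by rewrite /code renorm_tower//; exact: word_admissible. Qed.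

Lemma iter_renorm_code m a :
  iter m (@renorm R) (code a) = code (fun i => a (m + i)%N).
Proof.
elim: m => [//|m IH]; rewrite iterS IH renorm_code; congr code.
by apply/funext => i; rewrite /full_shift addnS.
Qed.

Lemma code_dom : range code `<=` @dom_renorm R.
Proof. by move=> _ [a _ <-]; apply: tower_dom; exact: word_admissible. Qed.

Lemma code_invariant : @renorm R @` range code `<=` range code.
Proof. by move=> _ [_ [a _ <-] <-]; exists (full_shift a) => //; rewrite renorm_code. Qed.

(** By [code_separated] each coordinate of the inverse is locally constant on the
range. *)
Lemma code_inverse_continuous (psi : C1space R -> shift_space n) :
  cancel code psi -> {within range code, continuous psi}.
Proof.
move=> codeK; apply/subspace_continuousP => _ [a _ <-].
apply: cvg_coordinates => i; have [e e0 h] := code_separated i.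
rewrite /from_subspace codeK near_withinE; near=> g => -[b _ bg].
rewrite -bg codeK; apply/esym/h; rewrite bg; near: g; exact: nbhsx_ballx.
Unshelve. all: by end_near. Qed.

Lemma code_inverse : (0 < n)%N ->
  exists psi : C1space R -> shift_space n, cancel code psi.
Proof.
move=> n0; pose psi (g : C1space R) : shift_space n :=
  if pselect (exists a, code a = g) is left h then sval (cid h)
  else fun=> Ordinal n0.
exists psi => a; rewrite /psi; case: pselect => [h|[]]; last by exists a.
by apply: code_inj; case: cid.
Qed.

Lemma code_conjugate : (0 < n)%N ->
  conjugate_on (@renorm R) (range code) (@full_shift n).
Proof.
move=> /code_inverse[psi codeK]; exists code, psi; split=> //.
- exact: code_continuous.
- exact: code_inverse_continuous.
- by move=> a; rewrite renorm_code.
Qed.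

Lemma code_compact : compact (range code).
Proof.
apply: continuous_compact; last exact: shift_space_compact.
exact/continuous_subspaceT/code_continuous.
Qed.

(** Renormalization is conjugate to the shift, which is continuous. *)
Lemma renorm_continuous : (0 < n)%N -> {within range code, continuous (@renorm R)}.
Proof.
move=> /code_inverse[psi codeK]; apply/subspace_continuousP => _ [a _ <-].
rewrite /from_subspace renorm_code.
have psia : psi g @[g --> within (range code) (nbhs (code a))] --> a.
  have /subspace_continuousP/(_ _ (imageT code a)) := code_inverse_continuous codeK.
  by rewrite /from_subspace codeK.
have : code (full_shift (psi g)) @[g --> within (range code) (nbhs (code a))]
    --> code (full_shift a).
  have shift_psi := cvg_comp _ _ psia (@full_shift_continuous n a).
  exact: (cvg_comp _ _ shift_psi (@code_continuous (full_shift a))).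
apply: cvg_trans; apply: near_eq_cvg; rewrite near_withinE.
by apply: nearW => _ [b _ <-]; rewrite codeK renorm_code.
Qed.

Section Entropy.
Context (n0 : (0 < n)%N).

Definition pad N (t : N.-tuple 'I_n) : shift_space n :=
  fun k => nth (Ordinal n0) t k.

Lemma pad_inj N : injective (@pad N).
Proof.
move=> t u tu; apply: eq_from_tnth => i.
by rewrite !(tnth_nth (Ordinal n0)); exact: (congr1 (@^~ (i : nat)) tu).
Qed.

(** Words of length [N] that differ at place [i < N] are told apart by the first
symbol after [i] renormalizations. *)
Lemma max_separated_code : exists2 e, 0 < e & forall N,
  ((n ^ N)%:R%:E <= max_separated (@renorm R) (range code) N e)%E.
Proof.
have [e e0 he] := code_separated 0; exists e => // N.
apply: ereal_sup_ubound => /=.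
exists [seq code (pad t) | t <- enum {: N.-tuple 'I_n}]; last first.
  by rewrite size_map -cardE card_tuple card_ord.
split; first by move=> _ /mapP[t _ ->]; exists (pad t).
split; first by rewrite map_inj_uniq ?enum_uniq// => t u /code_inj/pad_inj.
move=> _ _ /mapP[t _ ->] /mapP[u _ ->] tu.
have /existsP[i ti] : [exists i, tnth t i != tnth u i].
  apply: contraR tu => /existsPn tu; apply/eqP; congr (code (pad _)).
  by apply: eq_from_tnth => i; apply/eqP; have := tu i; rewrite negbK.
exists i => //; rewrite !iter_renorm_code => /he; rewrite addn0 => tui.
by move/eqP: ti; apply; rewrite !(tnth_nth (Ordinal n0)).
Qed.

Lemma htop_code : ((ln n%:R)%:E <= htop (@renorm R) (range code))%E.
Proof.
have [e e0 he] := max_separated_code.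
apply: (@le_trans _ _ (limn_esup (fun N => (N.+1%:R^-1)%:E *
    lne (max_separated (@renorm R) (range code) N.+1 e))%E)); last first.
  by apply: ereal_sup_ubound; exists e.
have lnN N : ((ln n%:R)%:E <= (N.+1%:R^-1)%:E *
    lne (max_separated (@renorm R) (range code) N.+1 e))%E.
  have nN0 : 0 < (n ^ N.+1)%:R :> R by rewrite ltr0n expn_gt0 n0.
  have -> : (ln n%:R)%:E = ((N.+1%:R^-1)%:E * lne (n ^ N.+1)%:R%:E)%E :> \bar R.
    rewrite lne_EFin// natrX lnXn ?ltr0n// -EFinM -[ln _ *+ _]mulr_natl.
    by rewrite mulKf// pnatr_eq0.
  apply: lee_wpmul2l; first by rewrite lee_fin invr_ge0 ler0n.
  rewrite lee_lne; [exact: he| |]; rewrite in_itv/= leey andbT ?lee_fin; first exact/ltW.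
  by apply: le_trans (he N.+1); rewrite lee_fin ltW.
rewrite limn_esup_lim; apply: lime_ge; first exact: is_cvg_esups.
apply: nearW => N; apply: le_trans (lnN N) _.
by apply: ereal_sup_ubound; exists N => /=.
Qed.

End Entropy.

End Words.

End Conjugacy.

Theorem mainTheorem8 (R : realType) :
  htop_sup (@renorm R) (@dom_renorm R) = +oo%E /\
  forall n : nat, (1 <= n)%N ->
    exists L : set (C1space R),
      [/\ L `<=` @dom_renorm R,
          @renorm R @` L `<=` L &
          conjugate_on (@renorm R) L (@full_shift n)].
Proof.
split; last first.
  move=> n n0; exists (range (@code R n)); split.
  - exact: code_dom.
  - exact: code_invariant.
  - exact: code_conjugate.
apply/eqyP => r _.
have [n nr] : exists n : nat, expR r <= n%:R.
  by exists (Num.bound (expR r)); exact/ltW/archi_boundP/expR_ge0.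
have n0 : (0 < n)%N by rewrite -(ltr0n R); exact: lt_le_trans (expR_gt0 r) nr.
apply: (@le_trans _ _ (htop (@renorm R) (range (@code R n)))).
  apply: le_trans (@htop_code R n n0); rewrite lee_fin -[leLHS]expRK.
  by rewrite ler_ln// posrE ?expR_gt0// ltr0n.
apply: ereal_sup_ubound; exists (range (@code R n)) => //; split.
- exact: code_compact.
- exact: code_dom.
- exact: code_invariant.
- exact: renorm_continuous.
Qed.
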